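(* The functor $\mathbf{PA}\to\mathbf{CPG}$, $P\mapsto(P,\overline{\mathscr C}(P),\nu)$, is a left adjoint to the forgetful functor $\mathbf{CPG}\to\mathbf{PA}$, $(P,\mathcal G,\varepsilon)\mapsto P$, and $\mathbf{PA}$ is coreflective in $\mathbf{CPG}$.
   Context: Maps are written to the right of their arguments and composed left to right, except that functors between large categories, and the maps $\varepsilon,\nu$ below, are written on the left. PROJECTION ALGEBRAS. A projection algebra is a set $P$ with unary operations $\theta_p:P\to P$ ($p\in P$) such that for all $p,q\in P$: $p\theta_p=p$; $\theta_p\theta_p=\theta_p$; $p\theta_q\theta_p=q\theta_p$; $\theta_p\theta_q\theta_p=\theta_{q\theta_p}$; $\theta_p\theta_q\theta_p\theta_q=\theta_p\theta_q$. $\mathbf{PA}$ is the category of projection algebras with morphisms the maps $\phi:P\to P'$ satisfying $(p\theta_q)\phi=(p\phi)\theta_{q\phi}$. On $P$ define $p\leq q$ iff $p=p\theta_q$ (a partial order); $p\leq_{\mathscr F}q$ iff $p=q\theta_p$; $p\mathrel{\mathscr F}q$ iff $p\leq_{\mathscr F}q$ and $q\leq_{\mathscr F}p$. ORDERED GROUPOIDS. Small categories are identified with their morphism sets, objects with identities; $\mathbf d(a),\mathbf r(a)$ are domain and range; $a\circ b$ is defined when $\mathbf r(a)=\mathbf d(b)$. An ordered groupoid is a groupoid $\mathcal G$ with a partial order $\leq$ such that: $a\leq b$ implies $\mathbf d(a)\leq\mathbf d(b)$, $\mathbf r(a)\leq\mathbf r(b)$, $a^{-1}\leq b^{-1}$;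 if $a\leq b$, $c\leq d$, $\mathbf r(a)=\mathbf d(c)$ and $\mathbf r(b)=\mathbf d(d)$ then $a\circ c\leq b\circ d$; and for all objects $p\leq\mathbf d(a)$, $q\leq\mathbf r(a)$ there are unique $u,v\leq a$ with $\mathbf d(u)=p$, $\mathbf r(v)=q$, written $u={}_p{\downharpoonleft}a$, $v=a{\downharpoonright}_q$ (restrictions). An ordered groupoid functor is an order-preserving functor. CHAIN GROUPOIDS. A $P$-path is a tuple $(p_1,\ldots,p_k)$ ($k\geq1$) with $p_1\mathrel{\mathscr F}\cdots\mathrel{\mathscr F}p_k$, regarded as a morphism $p_1\to p_k$. The path category $\mathscr P(P)$ consists of all $P$-paths under $(p_1,\ldots,p_k)\circ(p_k,\ldots,p_l)=(p_1,\ldots,p_k,\ldots,p_l)$, with identities $(p)$ identified with $p\in P$. Restrictions of paths are ${}_q{\downharpoonleft}(p_1,\ldots,p_k)=(q_1,\ldots,q_k)$ with $q_i=q\theta_{p_1}\cdots\theta_{p_i}$ for $q\leq p_1$, and $(p_1,\ldots,p_k){\downharpoonright}_r=(r_1,\ldots,r_k)$ with $r_i=r\theta_{p_k}\cdots\theta_{p_i}$ for $r\leq p_k$. Let $\approx$ be the (category) congruence on $\mathscr P(P)$ generated by (1) all $((p,p),(p))$, $p\in P$, and (2) all $((p,q,p),(p))$, $p\mathrel{\mathscr F}q$. The chain groupoid is $\mathscr C(P)=\mathscr P(P)/{\approx}$, with elements $[p_1,\ldots,p_k]$. For $p\in P$, $(e,f)\in P\times P$ is $p$-linked if $f=e\theta_p\theta_f$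 and $e=f\theta_p\theta_e$. Let $\equiv$ be the congruence generated by (1), (2) and (3) all pairs $((e,e\theta_p,f),(e,f\theta_p,f))$ with $(e,f)$ $p$-linked, $p\in P$. The reduced chain groupoid is $\overline{\mathscr C}(P)=\mathscr P(P)/{\equiv}$, with elements $[\![p_1,\ldots,p_k]\!]$. Both $\mathscr C(P)$ and $\overline{\mathscr C}(P)$ are ordered groupoids with object set $P$, inversion given by reversal of paths, restrictions induced from those of paths, and order: $\mathfrak c\leq\mathfrak d$ iff $\mathfrak c$ is a restriction of $\mathfrak d$. The quotient map is $\nu:\mathscr C(P)\to\overline{\mathscr C}(P)$, $\nu[p_1,\ldots,p_k]=[\![p_1,\ldots,p_k]\!]$. CHAINED PROJECTION GROUPOIDS. A weak projection groupoid is a pair $(P,\mathcal G)$ with $\mathcal G$ an ordered groupoid whose object set $P$ is a projection algebra, the order of $\mathcal G$ restricted to $P$ being the order $\leq$ of the projection algebra. For $a\in\mathcal G$ let $\vartheta_a:\{p\in P:p\leq\mathbf d(a)\}\to P$, $p\mapsto\mathbf r({}_p{\downharpoonleft}a)$, and $\Theta_a=\theta_{\mathbf d(a)}\vartheta_a:P\to P$. It is a projection groupoid if $\theta_{p\Theta_a}=\Theta_{a^{-1}}\theta_p\Theta_a$ for all $p\in P$, $a\in\mathcal G$. An evaluation map is a functor $\varepsilon:\mathscr C(P)\to\mathcal G$ with $\varepsilon(p)=p$ for $p\in P$ and $\varepsilon({}_p{\downharpoonleft}\mathfrak c)={}_p{\downharpoonleft}(\varepsilon(\mathfrak c))$ for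 $p\leq\mathbf d(\mathfrak c)$. For $b\in\mathcal G$, $(e,f)\in P\times P$ is $b$-linked if $f=e\Theta_b\theta_f$ and $e=f\Theta_{b^{-1}}\theta_e$; then put $e_1=e\theta_{\mathbf d(b)}$, $e_2=f\Theta_{b^{-1}}$, $f_1=e\Theta_b$, $f_2=f\theta_{\mathbf r(b)}$, $\lambda(e,b,f)=\varepsilon[e,e_1]\circ{}_{e_1}{\downharpoonleft}b\circ\varepsilon[f_1,f]$, $\rho(e,b,f)=\varepsilon[e,e_2]\circ{}_{e_2}{\downharpoonleft}b\circ\varepsilon[f_2,f]$. A chained projection groupoid is a triple $(P,\mathcal G,\varepsilon)$ with $(P,\mathcal G)$ a projection groupoid and $\varepsilon$ an evaluation map such that $\lambda(e,b,f)=\rho(e,b,f)$ for all $b\in\mathcal G$ and all $b$-linked $(e,f)$. $\mathbf{CPG}$ is the category of these, with morphisms $(P,\mathcal G,\varepsilon)\to(P',\mathcal G',\varepsilon')$ the ordered groupoid functors $\phi:\mathcal G\to\mathcal G'$ such that $\phi|_P:P\to P'$ is a projection algebra morphism and $(\varepsilon[p_1,\ldots,p_k])\phi=\varepsilon'[p_1\phi,\ldots,p_k\phi]$ whenever $p_1\mathrel{\mathscr F}\cdots\mathrel{\mathscr F}p_k$ in $P$. FUNCTORS. The functor $\mathbf{PA}\to\mathbf{CPG}$ sends $P$ to $(P,\overline{\mathscr C}(P),\nu)$ and $\phi:P\to P'$ to $[\![p_1,\ldots,p_k]\!]\mapsto[\![p_1\phi,\ldots,p_k\phi]\!]$. The forgetful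 functor sends $(P,\mathcal G,\varepsilon)$ to $P$ and $\phi$ to $\phi|_P$. A category $\mathbf C$ is coreflective in $\mathbf D$ if it is isomorphic to a full subcategory of $\mathbf D$ whose inclusion functor has a right adjoint, i.e. there is a full embedding $\mathbf C\to\mathbf D$ (injective on objects and morphisms, with full image) that has a right adjoint. *)

(* Defs.v *)
From HB Require Import structures.
From mathcomp Require Import all_boot generic_quotient.
From mathcomp Require Import boolp.

Set Implicit Arguments.
Unset Strict Implicit.
Unset Printing Implicit Defensive.

#[local] Obligation Tactic := idtac.

(* Composition is diagrammatic: [hcomp f g] is "first [f], then [g]". *)
Record category := Category {
  ob :> Type;
  hom : ob -> ob -> Type;
  idm : forall A, hom A A;
  hcomp : forall A B C, hom A B -> hom B C -> hom A C;
  hcomp1l : forall A B (f : hom A B), hcomp (idm A) f = f;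
  hcomp1r : forall A B (f : hom A B), hcomp f (idm B) = f;
  hcompA : forall A B C D (f : hom A B) (g : hom B C) (h : hom C D),
    hcomp (hcomp f g) h = hcomp f (hcomp g h)
}.

Record functor (C D : category) := Functor {
  fob :> C -> D;
  fmap : forall A B, hom A B -> hom (fob A) (fob B);
  fmap1 : forall A, fmap (idm A) = idm (fob A);
  fmapM : forall A B E (f : hom A B) (g : hom B E),
    fmap (hcomp f g) = hcomp (fmap f) (fmap g)
}.

Definition left_adjoint (C D : category) (F : functor C D) (G : functor D C) :
    Prop :=
  exists phi : forall (A : C) (X : D), hom (F A) X -> hom A (G X),
  [/\ forall A X, bijective (phi A X),
      forall A B X (f : hom A B) (u : hom (F B) X),
        phi A X (hcomp (fmap F f) u) = hcomp f (phi B X u)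
    & forall A X Y (u : hom (F A) X) (g : hom X Y),
        phi A Y (hcomp u g) = hcomp (phi A X u) (fmap G g)].

(* Injectivity on all morphisms amounts to injectivity on objects and on
   each hom-set. *)
Definition full_embedding (C D : category) (F : functor C D) : Prop :=
  [/\ injective (fob F),
      forall A B, injective (@fmap C D F A B)
    & forall A B (g : hom (F A) (F B)), exists f : hom A B, fmap F f = g].

Definition coreflective (C D : category) : Prop :=
  exists F : functor C D,
    full_embedding F /\ exists G : functor D C, left_adjoint F G.

Reserved Notation "x 'θ' p" (at level 40, left associativity).

(* [x θ p] is $x\theta_p$, so that [x θ p θ q] is $x\theta_p\theta_q$ and
   [x θ (p θ q)] is $x\theta_{p\theta_q}$. *)
Record projAlg := ProjAlg {
  pa_sort :> Type;
  proj : pa_sort -> pa_sort -> pa_sort where "x 'θ' p" := (proj x p);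
  proj_id : forall p, p θ p = p;
  projK : forall p x, x θ p θ p = x θ p;
  proj_back : forall p q, p θ q θ p = q θ p;
  proj_conj : forall p q x, x θ p θ q θ p = x θ (q θ p);
  proj_rep : forall p q x, x θ p θ q θ p θ q = x θ p θ q
}.

Notation "x 'θ' p" := (proj x p).

Definition ple (P : projAlg) (p q : P) : Prop := p = p θ q.
Definition pleF (P : projAlg) (p q : P) : Prop := p = q θ p.
Definition pF (P : projAlg) (p q : P) : Prop := pleF p q /\ pleF q p.

Lemma proj_ple (P : projAlg) (x p : P) : ple (x θ p) p.
Proof. by rewrite /ple projK. Qed.

Lemma ple_refl (P : projAlg) (p : P) : ple p p.
Proof. by rewrite /ple proj_id. Qed.

Lemma ple_projE (P : projAlg) (q p x : P) : ple q p -> x θ q = x θ p θ q θ p.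
Proof. by move=> qp; rewrite proj_conj -qp. Qed.

Lemma ple_projl (P : projAlg) (q p x : P) : ple q p -> x θ p θ q = x θ q.
Proof. by move=> qp; rewrite (ple_projE _ qp) projK -(ple_projE _ qp). Qed.

Lemma ple_projr (P : projAlg) (q p x : P) : ple q p -> x θ q θ p = x θ q.
Proof. by move=> qp; rewrite (ple_projE _ qp) projK. Qed.

Lemma ple_trans (P : projAlg) (p q r : P) : ple p q -> ple q r -> ple p r.
Proof. by move=> pq qr; rewrite /ple [in RHS]pq (ple_projr _ qr). Qed.

Lemma ple_anti (P : projAlg) (p q : P) : ple p q -> ple q p -> p = q.
Proof. by rewrite /ple => pq ->; rewrite -proj_back -pq proj_id. Qed.

Lemma pF_refl (P : projAlg) (p : P) : pF p p.
Proof. by split; rewrite /pleF proj_id. Qed.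

Lemma pF_sym (P : projAlg) (p q : P) : pF p q -> pF q p.
Proof. by case. Qed.

Lemma pF_projK (P : projAlg) (e p q : P) : pF p q -> ple e p -> e θ q θ p = e.
Proof.
move=> [pq qp] ep.
rewrite [in LHS]ep; rewrite /pleF in pq.
by rewrite proj_conj -pq -ep.
Qed.

Lemma pF_proj (P : projAlg) (e p q : P) : pF p q -> ple e p -> pF e (e θ q).
Proof.
move=> [pq qp] ep.
have qe : q θ e = e.
  by rewrite (ple_projE _ ep) -pq proj_back -ep.
split; rewrite /pleF; first by rewrite proj_back qe.
by rewrite -proj_conj proj_back proj_back.
Qed.

Definition plinked (P : projAlg) (p e f : P) : Prop :=
  f = e θ p θ f /\ e = f θ p θ e.

Record paMor (P Q : projAlg) := PaMor {
  pam :> P -> Q;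
  pamM : forall p q : P, pam (p θ q) = pam p θ pam q
}.

Lemma paMor_eq (P Q : projAlg) (f g : paMor P Q) : pam f = pam g -> f = g.
Proof.
case: f g => [f fM] [g gM] /= fg; case: _ / fg gM => gM.
by congr PaMor; exact: Prop_irrelevance.
Qed.

Definition paMor_id (P : projAlg) : paMor P P := @PaMor P P id (fun _ _ => erefl).

Program Definition paMor_comp (P Q R : projAlg) (f : paMor P Q) (g : paMor Q R) :
  paMor P R := @PaMor P R (fun p => g (f p)) _.
Next Obligation. by move=> P Q R f g p q /=; rewrite !pamM. Qed.

Program Definition PA : category :=
  @Category projAlg paMor paMor_id paMor_comp _ _ _.
Next Obligation. by move=> *; exact: paMor_eq. Qed.
Next Obligation. by move=> *; exact: paMor_eq. Qed.
Next Obligation. by move=> *; exact: paMor_eq. Qed.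

Lemma pam_pF (P Q : projAlg) (f : paMor P Q) (p q : P) :
  pF p q -> pF (f p) (f q).
Proof. by move=> [pq qp]; split; rewrite /pleF -pamM -?pq -?qp. Qed.

(* [mor G] is the set of all morphisms, with object set [P] embedded in it
   by [idn]; the order on objects is that on the identities. *)
Record ordGroupoid (P : Type) := OrdGroupoid {
  mor :> Type;
  dom : mor -> P;
  ran : mor -> P;
  idn : P -> mor;
  gcomp : forall a b : mor, ran a = dom b -> mor;
  ginv : mor -> mor;
  gle : mor -> mor -> Prop;
  dom_idn : forall p, dom (idn p) = p;
  ran_idn : forall p, ran (idn p) = p;
  dom_comp : forall a b (h : ran a = dom b), dom (gcomp h) = dom a;
  ran_comp : forall a b (h : ran a = dom b), ran (gcomp h) = ran b;
  gcomp1l : forall a (h : ran (idn (dom a)) = dom a), gcomp h = a;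
  gcomp1r : forall a (h : ran a = dom (idn (ran a))), gcomp h = a;
  gcompA : forall a b c (hab : ran a = dom b) (hbc : ran b = dom c)
    (h1 : ran (gcomp hab) = dom c) (h2 : ran a = dom (gcomp hbc)),
    gcomp h1 = gcomp h2;
  dom_inv : forall a, dom (ginv a) = ran a;
  ran_inv : forall a, ran (ginv a) = dom a;
  gcomp_inv_r : forall a (h : ran a = dom (ginv a)), gcomp h = idn (dom a);
  gcomp_inv_l : forall a (h : ran (ginv a) = dom a), gcomp h = idn (ran a);
  gle_refl : forall a, gle a a;
  gle_anti : forall a b, gle a b -> gle b a -> a = b;
  gle_trans : forall a b c, gle a b -> gle b c -> gle a c;
  gle_dom : forall a b, gle a b -> gle (idn (dom a)) (idn (dom b));
  gle_ran : forall a b, gle a b -> gle (idn (ran a)) (idn (ran b));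
  gle_inv : forall a b, gle a b -> gle (ginv a) (ginv b);
  gle_comp : forall a b c d (hac : ran a = dom c) (hbd : ran b = dom d),
    gle a b -> gle c d -> gle (gcomp hac) (gcomp hbd);
  restl_ex : forall a p, gle (idn p) (idn (dom a)) ->
    exists! u, gle u a /\ dom u = p;
  restr_ex : forall a q, gle (idn q) (idn (ran a)) ->
    exists! v, gle v a /\ ran v = q
}.

Definition restl (P : Type) (G : ordGroupoid P) (p : P) (a : G)
  (h : gle (idn G p) (idn G (dom a))) : G := sval (cid (restl_ex h)).

Lemma restlP (P : Type) (G : ordGroupoid P) (p : P) (a : G)
  (h : gle (idn G p) (idn G (dom a))) : gle (restl h) a /\ dom (restl h) = p.
Proof. by rewrite /restl; case: cid => u [] /=. Qed.

Lemma restl_uniq (P : Type) (G : ordGroupoid P) (p : P) (a u : G)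
  (h : gle (idn G p) (idn G (dom a))) : gle u a -> dom u = p -> restl h = u.
Proof. by move=> ua up; rewrite /restl; case: cid => v [] /= _; apply. Qed.

Lemma gcomp_eq (P : Type) (G : ordGroupoid P) (a a' b b' : G)
  (h : ran a = dom b) (h' : ran a' = dom b') :
  a = a' -> b = b' -> gcomp h = gcomp h'.
Proof.
by move=> aa bb; subst a' b'; congr gcomp; exact: Prop_irrelevance.
Qed.

Lemma invK (P : Type) (G : ordGroupoid P) (a : G) : ginv (ginv a) = a.
Proof.
have h1 : ran a = dom (ginv a) by rewrite dom_inv.
have h2 : ran (ginv a) = dom (ginv (ginv a)) by rewrite dom_inv.
have h3 : ran (gcomp h1) = dom (ginv (ginv a)) by rewrite ran_comp.
have h4 : ran a = dom (gcomp h2) by rewrite dom_comp.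
have := gcompA h3 h4.
have h5 : ran (idn G (dom (ginv (ginv a)))) = dom (ginv (ginv a)) by rewrite ran_idn.
have h6 : ran a = dom (idn G (ran a)) by rewrite dom_idn.
rewrite (@gcomp_eq _ _ _ _ _ _ h3 h5) ?gcomp1l //; last first.
  by rewrite gcomp_inv_r dom_inv ran_inv.
rewrite (@gcomp_eq _ _ _ _ _ _ h4 h6) ?gcomp1r //.
by rewrite gcomp_inv_r dom_inv.
Qed.

(* Functors of groupoids, as an object map with a morphism map; [h'] follows
   from [gf_dom] and [gf_ran]. *)
Record gfunctor_spec (P Q : Type) (G : ordGroupoid P) (H : ordGroupoid Q)
    (fo : P -> Q) (fm : G -> H) : Prop := GfunctorSpec {
  gf_dom : forall a, dom (fm a) = fo (dom a);
  gf_ran : forall a, ran (fm a) = fo (ran a);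
  gf_idn : forall p, fm (idn G p) = idn H (fo p);
  gf_comp : forall (a b : G) (h : ran a = dom b) (h' : ran (fm a) = dom (fm b)),
    fm (gcomp h) = gcomp h'
}.

(* Adjacency in [path] must be boolean; [`[< _ >]] is classical truth.
   The path $(p_1,\dots,p_k)$ has head $p_1$ and tail $(p_2,\dots,p_k)$. *)
Definition pFb (P : projAlg) : rel P := fun p q => `[< pF p q >].

Record ppath (P : projAlg) := PPath {
  phead : P;
  ptail : seq P;
  ppathP : path (@pFb P) phead ptail
}.

HB.instance Definition _ (P : projAlg) := gen_eqMixin (ppath P).
HB.instance Definition _ (P : projAlg) := gen_choiceMixin (ppath P).

Definition pseq (P : projAlg) (s : ppath P) : seq P := phead s :: ptail s.

Lemma ppath_eq (P : projAlg) (s t : ppath P) : pseq s = pseq t -> s = t.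
Proof.
case: s t => [x s sP] [y t tP] [/= xy st]; case: _ / xy tP => tP.
by case: _ / st tP => tP; congr PPath; exact: bool_irrelevance.
Qed.

Definition pdom (P : projAlg) (s : ppath P) : P := phead s.
Definition pran (P : projAlg) (s : ppath P) : P := last (phead s) (ptail s).
Definition pid (P : projAlg) (p : P) : ppath P := @PPath P p [::] isT.

Program Definition pedge (P : projAlg) (p q : P) (h : pF p q) : ppath P :=
  @PPath P p [:: q] _.
Next Obligation. by move=> P p q h; rewrite /= andbT; exact/asboolP. Qed.

Program Definition pcomp (P : projAlg) (s t : ppath P) (h : pran s = pdom t) :
  ppath P := @PPath P (phead s) (ptail s ++ ptail t) _.
Next Obligation.
by move=> P s t h; rewrite cat_path ppathP -/(pran s) h ppathP.
Qed.

Program Definition ppath_rev (P : projAlg) (s : ppath P) : ppath P :=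
  @PPath P (last (phead s) (ptail s)) (rev (belast (phead s) (ptail s))) _.
Next Obligation.
move=> P s; rewrite rev_path; apply: sub_path (ppathP s) => p q /asboolP pq.
by apply/asboolP/pF_sym.
Qed.

(* Left restriction $(q\theta_{p_1}, q\theta_{p_1}\theta_{p_2}, \dots)$; it is
   only used for $q \leq p_1$, but it is a path for every $q$. *)
Program Definition prestl (P : projAlg) (q : P) (s : ppath P) : ppath P :=
  @PPath P (q θ phead s) (scanl (@proj P) (q θ phead s) (ptail s)) _.
Next Obligation.
move=> P q [x s /= sP]; have := proj_ple q x.
elim: s x (q θ x) sP => //= y s IH x z /andP[/asboolP xy sP] zx.
apply/andP; split; first by apply/asboolP; exact: pF_proj xy zx.
by apply: (IH y) => //; exact: proj_ple.
Qed.

Program Definition ppath_map (P Q : projAlg) (f : paMor P Q) (s : ppath P) : ppath Q :=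
  @PPath Q (f (phead s)) (map f (ptail s)) _.
Next Obligation.
move=> P Q f s; apply: homo_path (ppathP s) => p q /asboolP pq.
by apply/asboolP/pam_pF.
Qed.

Lemma pran_pcomp (P : projAlg) (s t : ppath P) (h : pran s = pdom t) :
  pran (pcomp h) = pran t.
Proof. by rewrite /pran /= last_cat -/(pran s) h. Qed.

Lemma pdom_prev (P : projAlg) (s : ppath P) : pdom (ppath_rev s) = pran s.
Proof. by []. Qed.

Lemma pran_prev (P : projAlg) (s : ppath P) : pran (ppath_rev s) = pdom s.
Proof.
rewrite /pran /pdom; case: s => x [|y s] //= _.
by rewrite rev_cons last_rcons.
Qed.

Lemma pseq_prev (P : projAlg) (s : ppath P) : pseq (ppath_rev s) = rev (pseq s).
Proof. by rewrite /pseq [in RHS]lastI rev_rcons. Qed.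

Lemma prevK (P : projAlg) (s : ppath P) : ppath_rev (ppath_rev s) = s.
Proof. by apply: ppath_eq; rewrite !pseq_prev revK. Qed.

Lemma pseq_pcomp (P : projAlg) (s t : ppath P) (h : pran s = pdom t) :
  pseq (pcomp h) = belast (phead s) (ptail s) ++ pseq t.
Proof.
rewrite /pseq /= -cat_cons lastI -cats1 -catA /=.
by rewrite -/(pran s) h.
Qed.

Lemma prev_pcomp (P : projAlg) (s t : ppath P) (h : pran s = pdom t)
  (h' : pran (ppath_rev t) = pdom (ppath_rev s)) : ppath_rev (pcomp h) = pcomp h'.
Proof.
by apply: ppath_eq; rewrite pseq_prev pseq_pcomp rev_cat -pseq_prev.
Qed.

Lemma prestl_pdom (P : projAlg) (s : ppath P) : prestl (pdom s) s = s.
Proof.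
apply: ppath_eq; rewrite /pseq /pdom /= proj_id; congr cons.
case: s => x s /=; elim: s x => //= y s IH x /andP[/asboolP[_ xy] sP].
by rewrite -xy IH.
Qed.

Lemma prestl_proj (P : projAlg) (q : P) (s : ppath P) :
  prestl (q θ pdom s) s = prestl q s.
Proof. by apply: ppath_eq; rewrite /pseq /= projK. Qed.

Lemma prestl_prestl (P : projAlg) (p q : P) (s : ppath P) :
  ple q (pdom s) -> ple p q -> prestl p (prestl q s) = prestl p s.
Proof.
move=> qs pq; apply: ppath_eq; rewrite /pseq /=.
have ps : p = p θ phead s by exact: ple_trans pq qs.
rewrite -qs -pq -ps; congr cons.
elim: (ptail s) p q pq {qs ps} => //= y t IH p q pq.
have E : p θ (q θ y) = p θ y by rewrite -proj_conj [in LHS]pq proj_rep -pq.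
by rewrite E IH // /ple -proj_conj projK proj_conj E.
Qed.

Lemma last_scanl (P : projAlg) (q : P) (t : seq P) :
  last q (scanl (@proj P) q t) = foldl (@proj P) q t.
Proof. by elim: t q => //= y t IH q. Qed.

Lemma pran_prestl (P : projAlg) (q : P) (s : ppath P) :
  pran (prestl q s) = foldl (@proj P) q (pseq s).
Proof. by rewrite /pran /= last_scanl. Qed.

Lemma pran_prestl_ple (P : projAlg) (q : P) (s : ppath P) :
  ple (pran (prestl q s)) (pran s).
Proof.
rewrite /pran /=; move: (proj_ple q (phead s)).
elim: (ptail s) (phead s) (q θ _) => //= y t IH x z zx.
by apply: IH; exact: proj_ple.
Qed.

Lemma prev_prestl (P : projAlg) (q : P) (s : ppath P) :
  ppath_rev (prestl q s) = prestl (pran (prestl q s)) (ppath_rev s).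
Proof.
apply: ppath_eq; rewrite /pseq.
have := pran_prestl_ple q s; rewrite /ple => E.
rewrite [in RHS]/= -/(pran s) -E [in LHS]/= -/(pran (prestl q s)); congr cons.
rewrite /pran /= => {E}; have := proj_ple q (phead s).
case: s => x s /= sP; elim: s x (q θ x) sP => //= y s IH x z.
move=> /andP[/asboolP xy sP] zx.
rewrite !rev_cons -cats1 -[in RHS]cats1 scanl_cat.
rewrite -(IH y) //; last exact: proj_ple.
congr cat; rewrite /= -last_scanl -(IH y) //; last exact: proj_ple.
congr cons.
case: (scanl _ _ _) => /= [|w u]; last rewrite rev_cons last_rcons.
  by rewrite pF_projK.
by rewrite pF_projK.
Qed.

Lemma prestl_pcomp (P : projAlg) (q : P) (s t : ppath P) (h : pran s = pdom t)
  (h' : pran (prestl q s) = pdom (prestl (pran (prestl q s)) t)) :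
  prestl q (pcomp h) = pcomp h'.
Proof.
apply: ppath_eq; rewrite /pseq /= scanl_cat; congr (_ :: _ ++ _).
have := pran_prestl_ple q s; rewrite h /ple /pdom => <-.
by rewrite /pran /= last_scanl.
Qed.

Inductive cong_gen (P : projAlg) (R : ppath P -> ppath P -> Prop) :
    ppath P -> ppath P -> Prop :=
| cg_gen s t : R s t -> cong_gen R s t
| cg_refl s : cong_gen R s s
| cg_sym s t : cong_gen R s t -> cong_gen R t s
| cg_trans s t u : cong_gen R s t -> cong_gen R t u -> cong_gen R s u
| cg_comp s s' t t' (h : pran s = pdom t) (h' : pran s' = pdom t') :
    cong_gen R s s' -> cong_gen R t t' -> cong_gen R (pcomp h) (pcomp h').

(* Congruences whose quotient inherits inversion and restrictions. *)
Record pathCong (P : projAlg) := PathCong {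
  pcg :> ppath P -> ppath P -> Prop;
  pcg_refl : forall s, pcg s s;
  pcg_sym : forall s t, pcg s t -> pcg t s;
  pcg_trans : forall s t u, pcg s t -> pcg t u -> pcg s u;
  pcg_comp : forall s s' t t' (h : pran s = pdom t) (h' : pran s' = pdom t'),
    pcg s s' -> pcg t t' -> pcg (pcomp h) (pcomp h');
  pcg_dom : forall s t, pcg s t -> pdom s = pdom t;
  pcg_ran : forall s t, pcg s t -> pran s = pran t;
  pcg_prev : forall s t, pcg s t -> pcg (ppath_rev s) (ppath_rev t);
  pcg_prestl : forall q s t, pcg s t -> pcg (prestl q s) (prestl q t);
  pcg_inv : forall s (h : pran s = pdom (ppath_rev s)), pcg (pcomp h) (pid (pdom s))
}.

(* Generating pairs are given by their underlying sequences, so that no proof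
   that these are paths is needed here: $(p,p)$ and $(p,q,p)$ are paths
   whenever $p\mathrel{\mathscr F}q$, and [plinked_pF] below shows that the
   two sequences attached to a linked pair are. *)
Inductive chain_gen (P : projAlg) (s t : ppath P) : Prop :=
| chain_gen_dup p : pseq s = [:: p; p] -> pseq t = [:: p] -> chain_gen s t
| chain_gen_back p q : pseq s = [:: p; q; p] -> pseq t = [:: p] -> chain_gen s t.

Inductive rchain_gen (P : projAlg) (s t : ppath P) : Prop :=
| rchain_gen_chain : chain_gen s t -> rchain_gen s t
| rchain_gen_linked p e f : plinked p e f ->
    pseq s = [:: e; e θ p; f] -> pseq t = [:: e; f θ p; f] -> rchain_gen s t.

Lemma cong_gen_dom (P : projAlg) (R : ppath P -> ppath P -> Prop) :
  (forall s t, R s t -> pdom s = pdom t) ->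
  forall s t, cong_gen R s t -> pdom s = pdom t.
Proof.
by move=> HR s t; elim=> {s t} //=; move=> s t u _ -> _ ->.
Qed.

Lemma cong_gen_ran (P : projAlg) (R : ppath P -> ppath P -> Prop) :
  (forall s t, R s t -> pran s = pran t) ->
  forall s t, cong_gen R s t -> pran s = pran t.
Proof.
move=> HR s t; elim=> {s t} //=; first by move=> s t u _ -> _ ->.
by move=> s s' t t' h h' _ _ _ tt; rewrite !pran_pcomp.
Qed.

Lemma cong_gen_prev (P : projAlg) (R : ppath P -> ppath P -> Prop) :
  (forall s t, R s t -> cong_gen R (ppath_rev s) (ppath_rev t)) ->
  forall s t, cong_gen R s t -> cong_gen R (ppath_rev s) (ppath_rev t).
Proof.
move=> HR s t; elim=> {s t} //=.
- by move=> s; exact: cg_refl.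
- by move=> s t _; exact: cg_sym.
- by move=> s t u _ st _; exact: cg_trans st.
move=> s s' t t' h h' _ ss _ tt.
have k : pran (ppath_rev t) = pdom (ppath_rev s) by rewrite pran_prev pdom_prev.
have k' : pran (ppath_rev t') = pdom (ppath_rev s') by rewrite pran_prev pdom_prev.
by rewrite (prev_pcomp h k) (prev_pcomp h' k'); exact: cg_comp.
Qed.

Lemma prestl_dom (P : projAlg) (q : P) (s t : ppath P) (h : pran s = pdom t) :
  pran (prestl q s) = pdom (prestl (pran (prestl q s)) t).
Proof. by have := pran_prestl_ple q s; rewrite h. Qed.

Lemma cong_gen_prestl (P : projAlg) (R : ppath P -> ppath P -> Prop) :
  (forall q s t, R s t -> cong_gen R (prestl q s) (prestl q t)) ->
  (forall q s t, R s t -> pran (prestl q s) = pran (prestl q t)) ->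
  forall q s t, cong_gen R s t -> cong_gen R (prestl q s) (prestl q t).
Proof.
move=> HR Hq q s t st.
suff : forall q, cong_gen R (prestl q s) (prestl q t) /\
                 pran (prestl q s) = pran (prestl q t) by move=> /(_ q)[].
elim: st => {q s t} //=.
- by move=> s t st q; split; [exact: HR|exact: Hq].
- by move=> s q; split=> //; exact: cg_refl.
- by move=> s t _ IH q; case: (IH q) => ? ->; split=> //; exact: cg_sym.
- move=> s t u _ IH _ IH' q; case: (IH q) (IH' q) => a -> [b ->].
  by split=> //; exact: cg_trans a b.
move=> s s' t t' h h' _ IHs _ IHt q.
have [a b] := IHs q; have [c d] := IHt (pran (prestl q s)).
rewrite (prestl_pcomp h (prestl_dom q h)) (prestl_pcomp h' (prestl_dom q h')).
rewrite !pran_pcomp d {2}b; split=> //.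
by apply: cg_comp => //; rewrite -b.
Qed.

Lemma cong_gen_inv (P : projAlg) (R : ppath P -> ppath P -> Prop) :
  (forall s t, chain_gen s t -> R s t) ->
  forall s (h : pran s = pdom (ppath_rev s)), cong_gen R (pcomp h) (pid (pdom s)).
Proof.
move=> HR [x s sP]; elim: s x sP => [|y s IH] x sP h.
  have -> : pcomp h = pid x by exact: ppath_eq.
  exact: cg_refl.
have /= /andP[/asboolP xy tP] := sP.
set t := PPath tP.
have k : pran t = pdom (ppath_rev t) by [].
have k1 : pran (pedge xy) = pdom (pcomp k) by [].
have k2 : pran (pcomp k1) = pdom (pedge (pF_sym xy)).
  by rewrite !pran_pcomp pran_prev.
have -> : pcomp h = pcomp k2.
  apply: ppath_eq; rewrite /pseq /=; congr [:: _, _ & _].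
  by rewrite -catA rev_cons cats1.
have k3 : pran (pedge xy) = pdom (pid y) by [].
have k4 : pran (pcomp k3) = pdom (pedge (pF_sym xy)) by [].
apply: (@cg_trans _ _ _ (pcomp k4)).
  apply: cg_comp; last exact: cg_refl.
  by apply: cg_comp; [exact: cg_refl | exact: IH].
by apply/cg_gen/HR; apply: (@chain_gen_back _ _ _ x y).
Qed.

Lemma pdomE (P : projAlg) (s : ppath P) x l : pseq s = x :: l -> pdom s = x.
Proof. by case. Qed.

Lemma pseq_path (P : projAlg) (s : ppath P) x l :
  pseq s = x :: l -> path (@pFb P) x l.
Proof. by move=> sE; have := ppathP s; case: sE => -> ->. Qed.

Lemma pranE (P : projAlg) (s : ppath P) x l :
  pseq s = x :: l -> pran s = last x l.
Proof. by rewrite /pran => -[-> ->]. Qed.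

Lemma chain_gen_dom (P : projAlg) (s t : ppath P) :
  chain_gen s t -> pdom s = pdom t.
Proof.
by case=> [p|p q] /pdomE-> /pdomE->.
Qed.

Lemma chain_gen_ran (P : projAlg) (s t : ppath P) :
  chain_gen s t -> pran s = pran t.
Proof.
by case=> [p|p q] /pranE-> /pranE->.
Qed.

Lemma chain_gen_prev (P : projAlg) (s t : ppath P) :
  chain_gen s t -> chain_gen (ppath_rev s) (ppath_rev t).
Proof.
case=> [p|p q] sE tE; [apply: (@chain_gen_dup _ _ _ p)
                      |apply: (@chain_gen_back _ _ _ p q)];
  by rewrite pseq_prev ?sE ?tE.
Qed.

Lemma pseq_prestl (P : projAlg) (q : P) (s : ppath P) :
  pseq (prestl q s) = scanl (@proj P) q (pseq s).
Proof. by []. Qed.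

Lemma chain_gen_prestl (P : projAlg) (x : P) (s t : ppath P) :
  chain_gen s t -> chain_gen (prestl x s) (prestl x t).
Proof.
case=> [p|p q] sE tE; [apply: (@chain_gen_dup _ _ _ (x θ p))
                      |apply: (@chain_gen_back _ _ _ (x θ p) (x θ p θ q))];
  rewrite pseq_prestl ?sE ?tE //= ?projK //.
have : path (@pFb P) p [:: q; p] by case: s sE => y s sP [<- <-].
move=> /= /and3P[/asboolP pq _ _].
by rewrite (pF_projK pq) //; exact: proj_ple.
Qed.

Lemma rchain_gen_dom (P : projAlg) (s t : ppath P) :
  rchain_gen s t -> pdom s = pdom t.
Proof.
case; first exact: chain_gen_dom.
by move=> p e f _ /pdomE-> /pdomE->.
Qed.

Lemma rchain_gen_ran (P : projAlg) (s t : ppath P) :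
  rchain_gen s t -> pran s = pran t.
Proof.
case; first exact: chain_gen_ran.
by move=> p e f _ /pranE-> /pranE->.
Qed.

Lemma plinked_sym (P : projAlg) (p e f : P) : plinked p e f -> plinked p f e.
Proof. by case. Qed.

Lemma rchain_gen_prev (P : projAlg) (s t : ppath P) :
  rchain_gen s t -> cong_gen (@rchain_gen P) (ppath_rev s) (ppath_rev t).
Proof.
case=> [st|p e f l sE tE].
  by apply/cg_gen/rchain_gen_chain; exact: chain_gen_prev.
apply/cg_sym/cg_gen/(@rchain_gen_linked _ _ _ p f e); first exact: plinked_sym.
  by rewrite pseq_prev tE.
by rewrite pseq_prev sE.
Qed.

Lemma rchain_gen_prestl (P : projAlg) (x : P) (s t : ppath P) :
  rchain_gen s t -> rchain_gen (prestl x s) (prestl x t).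
Proof.
case=> [st|p e f [fE eE] sE tE].
  by apply: rchain_gen_chain; exact: chain_gen_prestl.
pose g := x θ e; pose h := g θ p θ f.
have ge : ple g e by exact: proj_ple.
have hf : ple h f by exact: proj_ple.
have hpe : h θ p θ e = g.
  by rewrite /h [in LHS]ge [_ θ f θ p]proj_conj proj_conj -eE -ge.
have gep : g θ (e θ p) = g θ p by rewrite -proj_conj [in LHS]ge proj_rep -ge.
apply: (@rchain_gen_linked _ _ _ p g h).
- split; first by rewrite -(ple_projl _ hf) proj_id.
  by rewrite -(ple_projl _ ge) hpe proj_id.
- by rewrite pseq_prestl sE /= -/g gep.
- by rewrite pseq_prestl tE /= -/g -(proj_conj p f g) -/h /h proj_rep.
Qed.

Lemma chain_gen_pran_prestl (P : projAlg) (x : P) (s t : ppath P) :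
  chain_gen s t -> pran (prestl x s) = pran (prestl x t).
Proof. by move=> /(chain_gen_prestl x)/chain_gen_ran. Qed.

Program Definition chain_cong (P : projAlg) : pathCong P :=
  @PathCong P (cong_gen (@chain_gen P)) (@cg_refl _ _) (@cg_sym _ _)
    (@cg_trans _ _) (@cg_comp _ _) _ _ _ _ _.
Next Obligation. by move=> P; apply: cong_gen_dom; exact: chain_gen_dom. Qed.
Next Obligation. by move=> P; apply: cong_gen_ran; exact: chain_gen_ran. Qed.
Next Obligation.
by move=> P; apply: cong_gen_prev => s t /chain_gen_prev; exact: cg_gen.
Qed.
Next Obligation.
move=> P; apply: cong_gen_prestl => q s t /(chain_gen_prestl q).
  exact: cg_gen.
exact: chain_gen_ran.
Qed.
Next Obligation. by move=> P; exact: cong_gen_inv. Qed.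

Program Definition rchain_cong (P : projAlg) : pathCong P :=
  @PathCong P (cong_gen (@rchain_gen P)) (@cg_refl _ _) (@cg_sym _ _)
    (@cg_trans _ _) (@cg_comp _ _) _ _ _ _ _.
Next Obligation. by move=> P; apply: cong_gen_dom; exact: rchain_gen_dom. Qed.
Next Obligation. by move=> P; apply: cong_gen_ran; exact: rchain_gen_ran. Qed.
Next Obligation. by move=> P; apply: cong_gen_prev; exact: rchain_gen_prev. Qed.
Next Obligation.
move=> P; apply: cong_gen_prestl => q s t /(rchain_gen_prestl q).
  exact: cg_gen.
exact: rchain_gen_ran.
Qed.
Next Obligation.
by move=> P; apply: cong_gen_inv => s t; exact: rchain_gen_chain.
Qed.

Definition pcgb (P : projAlg) (R : pathCong P) : rel (ppath P) :=
  fun s t => `[< R s t >].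

Lemma pcgb_refl (P : projAlg) (R : pathCong P) : reflexive (pcgb R).
Proof. by move=> s; apply/asboolP; exact: pcg_refl. Qed.

Lemma pcgb_sym (P : projAlg) (R : pathCong P) : symmetric (pcgb R).
Proof. by move=> s t; apply/asboolP/asboolP; exact: pcg_sym. Qed.

Lemma pcgb_trans (P : projAlg) (R : pathCong P) : transitive (pcgb R).
Proof.
by move=> t s u /asboolP st /asboolP tu; apply/asboolP; exact: pcg_trans tu.
Qed.

Canonical pcgb_equiv (P : projAlg) (R : pathCong P) :=
  EquivRel (pcgb R) (pcgb_refl R) (pcgb_sym R) (@pcgb_trans P R).

Definition qmor (P : projAlg) (R : pathCong P) : Type := {eq_quot (pcgb_equiv R)}%qT.

Definition pcls (P : projAlg) (R : pathCong P) (s : ppath P) : qmor R :=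
  (\pi_({eq_quot (pcgb_equiv R)}) s)%qT.

Definition prep (P : projAlg) (R : pathCong P) (c : qmor R) : ppath P :=
  repr (c : {eq_quot (pcgb_equiv R)}%qT).

Lemma pclsP (P : projAlg) (R : pathCong P) (s t : ppath P) :
  pcls R s = pcls R t <-> R s t.
Proof.
split; first by move/eqmodP/asboolP.
by move=> st; apply/eqmodP/asboolP.
Qed.

Lemma prepK (P : projAlg) (R : pathCong P) (c : qmor R) : pcls R (prep c) = c.
Proof. exact: reprK. Qed.

Lemma qmorW (P : projAlg) (R : pathCong P) (K : qmor R -> Prop) :
  (forall s, K (pcls R s)) -> forall c, K c.
Proof. by move=> H c; rewrite -(prepK c); exact: H. Qed.

Lemma pcls_prep (P : projAlg) (R : pathCong P) (s : ppath P) :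
  R (prep (pcls R s)) s.
Proof. by apply/pclsP; rewrite prepK. Qed.

Definition qdom (P : projAlg) (R : pathCong P) (c : qmor R) : P := pdom (prep c).
Definition qran (P : projAlg) (R : pathCong P) (c : qmor R) : P := pran (prep c).
Definition qidn (P : projAlg) (R : pathCong P) (p : P) : qmor R := pcls R (pid p).
Definition qcomp (P : projAlg) (R : pathCong P) (c d : qmor R)
  (h : qran c = qdom d) : qmor R := pcls R (pcomp h).
Definition qinv (P : projAlg) (R : pathCong P) (c : qmor R) : qmor R :=
  pcls R (ppath_rev (prep c)).
(* [c] is a left restriction of [d]; the right restrictions are the same
   elements, by [prev_prestl]. *)
Definition qle (P : projAlg) (R : pathCong P) (c d : qmor R) : Prop :=
  exists s q, [/\ d = pcls R s, ple q (pdom s) & c = pcls R (prestl q s)].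

Lemma qdom_pcls (P : projAlg) (R : pathCong P) (s : ppath P) :
  qdom (pcls R s) = pdom s.
Proof. exact: pcg_dom (pcls_prep R s). Qed.

Lemma qran_pcls (P : projAlg) (R : pathCong P) (s : ppath P) :
  qran (pcls R s) = pran s.
Proof. exact: pcg_ran (pcls_prep R s). Qed.

Lemma qinv_pcls (P : projAlg) (R : pathCong P) (s : ppath P) :
  qinv (pcls R s) = pcls R (ppath_rev s).
Proof. by apply/pclsP/pcg_prev/pcls_prep. Qed.

Lemma qcomp_pcls (P : projAlg) (R : pathCong P) (s t : ppath P)
  (h : qran (pcls R s) = qdom (pcls R t)) (h' : pran s = pdom t) :
  qcomp h = pcls R (pcomp h').
Proof. by apply/pclsP/pcg_comp; exact: pcls_prep. Qed.

Lemma qcompE (P : projAlg) (R : pathCong P) (c d : qmor R) (s t : ppath P)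
  (h : qran c = qdom d) (h' : pran s = pdom t) :
  c = pcls R s -> d = pcls R t -> qcomp h = pcls R (pcomp h').
Proof. by move=> cs dt; subst c d; exact: qcomp_pcls. Qed.

Lemma pdom_prestl (P : projAlg) (q : P) (s : ppath P) :
  ple q (pdom s) -> pdom (prestl q s) = q.
Proof. by move=> /esym. Qed.

Lemma qleP (P : projAlg) (R : pathCong P) (s t : ppath P) :
  qle (pcls R s) (pcls R t) <->
  ple (pdom s) (pdom t) /\ R s (prestl (pdom s) t).
Proof.
split=> [[u [q [/pclsP tu qu /pclsP su]]]|[st sr]].
  have sq : pdom s = q by rewrite (pcg_dom su) pdom_prestl.
  rewrite (pcg_dom tu) sq; split=> //.
  by apply: pcg_trans su _; apply/pcg_prestl/pcg_sym.
by exists t, (pdom s); split=> //; apply/pclsP.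
Qed.

Lemma qle_prestl (P : projAlg) (R : pathCong P) (q : P) (s : ppath P) :
  ple q (pdom s) -> qle (pcls R (prestl q s)) (pcls R s).
Proof. by move=> qs; exists s, q. Qed.

Lemma qle_idn (P : projAlg) (R : pathCong P) (p q : P) :
  qle (qidn R p) (qidn R q) <-> ple p q.
Proof.
split; first by move/qleP=> [].
move=> pq; apply/qleP; split=> //.
suff -> : prestl p (pid q) = pid p by exact: pcg_refl.
by apply: ppath_eq; rewrite /pseq /= -pq.
Qed.

Lemma qle_ran (P : projAlg) (R : pathCong P) (c d : qmor R) :
  qle c d -> ple (qran c) (qran d).
Proof.
by move=> [s [q [-> _ ->]]]; rewrite !qran_pcls; exact: pran_prestl_ple.
Qed.

Lemma qle_dom (P : projAlg) (R : pathCong P) (c d : qmor R) :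
  qle c d -> ple (qdom c) (qdom d).
Proof.
by move=> [s [q [-> ? ->]]]; rewrite !qdom_pcls pdom_prestl.
Qed.

Lemma qle_inv (P : projAlg) (R : pathCong P) (c d : qmor R) :
  qle c d -> qle (qinv c) (qinv d).
Proof.
move=> [s [q [-> qs ->]]]; rewrite !qinv_pcls prev_prestl.
by apply: qle_prestl; exact: pran_prestl_ple.
Qed.

Lemma qinvK (P : projAlg) (R : pathCong P) : involutive (@qinv P R).
Proof. by apply: qmorW => s; rewrite !qinv_pcls prevK. Qed.

Lemma qdom_qinv (P : projAlg) (R : pathCong P) (c : qmor R) :
  qdom (qinv c) = qran c.
Proof. by elim/qmorW: c => s; rewrite qinv_pcls qdom_pcls qran_pcls. Qed.

Lemma qran_qinv (P : projAlg) (R : pathCong P) (c : qmor R) :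
  qran (qinv c) = qdom c.
Proof.
by elim/qmorW: c => s; rewrite qinv_pcls qdom_pcls qran_pcls pran_prev.
Qed.

Lemma qle_uniq (P : projAlg) (R : pathCong P) (b c d : qmor R) :
  qle b d -> qle c d -> qdom b = qdom c -> b = c.
Proof.
elim/qmorW: d => s; elim/qmorW: b => t; elim/qmorW: c => u.
move=> /qleP[_ ts] /qleP[_ us]; rewrite !qdom_pcls => tu.
by apply/pclsP; apply: pcg_trans ts _; rewrite tu; exact: pcg_sym.
Qed.

Lemma qle_refl (P : projAlg) (R : pathCong P) (c : qmor R) : qle c c.
Proof.
elim/qmorW: c => s; apply/qleP; rewrite prestl_pdom.
by split; [exact: ple_refl|exact: pcg_refl].
Qed.

Program Definition quotGroupoid (P : projAlg) (R : pathCong P) : ordGroupoid P :=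
  @OrdGroupoid P (qmor R) (@qdom P R) (@qran P R) (@qidn P R) (@qcomp P R)
    (@qinv P R) (@qle P R)
    _ _ _ _ _ _ _ (@qdom_qinv P R) (@qran_qinv P R) _ _ _ _ _ _ _ (@qle_inv P R)
    _ _ _.
Next Obligation. by move=> P R p; rewrite qdom_pcls. Qed.
Next Obligation. by move=> P R p; rewrite qran_pcls. Qed.
Next Obligation. by move=> P R c d h; rewrite qdom_pcls. Qed.
Next Obligation. by move=> P R c d h; rewrite qran_pcls pran_pcomp. Qed.
Next Obligation.
move=> P R; apply: qmorW => s h.
have k : pran (pid (pdom s)) = pdom s by [].
rewrite (qcompE h k) ?qdom_pcls //; congr pcls.
exact: ppath_eq.
Qed.
Next Obligation.
move=> P R; apply: qmorW => s h.
have k : pran s = pdom (pid (pran s)) by [].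
rewrite (qcompE h k) ?qran_pcls //; congr pcls.
by apply: ppath_eq; rewrite /pseq /= cats0.
Qed.
Next Obligation.
move=> P R; apply: qmorW => s; apply: qmorW => t; apply: qmorW => u.
move=> hst htu h1 h2.
have kst : pran s = pdom t by rewrite -(qran_pcls R) hst qdom_pcls.
have ktu : pran t = pdom u by rewrite -(qran_pcls R) htu qdom_pcls.
have k1 : pran (pcomp kst) = pdom u by rewrite pran_pcomp.
have k2 : pran s = pdom (pcomp ktu) by [].
rewrite (qcompE h1 k1) ?(qcompE hst kst) // (qcompE h2 k2) ?(qcompE htu ktu) //.
by congr pcls; apply: ppath_eq; rewrite /pseq /= catA.
Qed.
Next Obligation.
move=> P R; apply: qmorW => s h.
have k : pran s = pdom (ppath_rev s) by [].
rewrite (qcompE h k) ?qinv_pcls // qdom_pcls.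
by apply/pclsP; exact: pcg_inv.
Qed.
Next Obligation.
move=> P R; apply: qmorW => s h.
have k : pran (ppath_rev s) = pdom (ppath_rev (ppath_rev s)) by [].
rewrite (qcompE h k) ?prevK ?qinv_pcls // qran_pcls.
by apply/pclsP; exact: pcg_inv.
Qed.
Next Obligation. by move=> P R c; exact: qle_refl. Qed.
Next Obligation.
move=> P R c d cd dc; apply: (qle_uniq cd (qle_refl d)).
by apply: ple_anti; exact: qle_dom.
Qed.
Next Obligation.
move=> P R; apply: qmorW => s; apply: qmorW => t; apply: qmorW => u.
move=> /qleP[st sE] /qleP[tu tE]; apply/qleP.
split; first exact: ple_trans tu.
apply: pcg_trans sE _; rewrite -(prestl_prestl tu st).
exact: pcg_prestl.
Qed.
Next Obligation. by move=> P R c d /qle_dom cd; apply/qle_idn. Qed.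
Next Obligation. by move=> P R c d /qle_ran cd; apply/qle_idn. Qed.
Next Obligation.
move=> P R; apply: qmorW => s; apply: qmorW => s'; apply: qmorW => t.
apply: qmorW => t' hst hst' /qleP[ss sE] /qleP[tt tE].
have kst : pran s = pdom t by rewrite -(qran_pcls R) hst qdom_pcls.
have kst' : pran s' = pdom t' by rewrite -(qran_pcls R) hst' qdom_pcls.
rewrite (qcompE hst kst) // (qcompE hst' kst') //.
apply/qleP; split=> //.
rewrite (prestl_pcomp kst' (prestl_dom (pdom s) kst')).
apply: pcg_comp => //.
by rewrite -(pcg_ran sE) kst.
Qed.
Next Obligation.
move=> P R; apply: qmorW => s q; rewrite qdom_pcls => /qle_idn qs.
exists (pcls R (prestl q s)); split.
  by split; [exact: qle_prestl | rewrite qdom_pcls pdom_prestl].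
move=> c [cs <-]; apply: (qle_uniq _ cs); first by apply: qle_prestl; rewrite -(qdom_pcls R); exact: qle_dom.
by rewrite qdom_pcls pdom_prestl // -(qdom_pcls R s); exact: qle_dom.
Qed.
Next Obligation.
move=> P R; apply: qmorW => s q; rewrite qran_pcls => /qle_idn qs.
have qs' : ple q (pdom (ppath_rev s)) by [].
have H : qle (qinv (pcls R (prestl q (ppath_rev s)))) (pcls R s).
  rewrite -[X in qle _ X]qinvK; apply: qle_inv; rewrite qinv_pcls.
  exact: qle_prestl.
have H' : qran (qinv (pcls R (prestl q (ppath_rev s)))) = q.
  by rewrite qran_qinv qdom_pcls pdom_prestl.
exists (qinv (pcls R (prestl q (ppath_rev s)))); split=> // c [cs cq].
rewrite -[RHS]qinvK; congr qinv; apply: (@qle_uniq _ _ _ _ (qinv (pcls R s))).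
- by rewrite qinv_pcls; exact: qle_prestl.
- exact: qle_inv.
by rewrite -qran_qinv H' qdom_qinv.
Qed.

(* $\mathscr C(P)$ and $\overline{\mathscr C}(P)$ *)
Definition chain (P : projAlg) : ordGroupoid P := quotGroupoid (chain_cong P).
Definition rchain (P : projAlg) : ordGroupoid P := quotGroupoid (rchain_cong P).

Lemma restl_pcls (P : projAlg) (R : pathCong P) (q : P) (s : ppath P)
  (h : gle (idn (quotGroupoid R) q) (idn (quotGroupoid R) (qdom (pcls R s)))) :
  restl (G := quotGroupoid R) h = pcls R (prestl q s).
Proof.
have qs : ple q (pdom s) by move: h => /qle_idn; rewrite qdom_pcls.
apply: restl_uniq; first exact: qle_prestl.
by rewrite /= qdom_pcls pdom_prestl.
Qed.

Record wpGroupoid (P : projAlg) := WPGroupoid {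
  wpg_og :> ordGroupoid P;
  wpg_le : forall p q : P, gle (idn wpg_og p) (idn wpg_og q) <-> ple p q
}.

(* $p\vartheta_a$; only meaningful for $p\leq\mathbf d(a)$, hence the
   proof argument *)
Definition vtheta (P : projAlg) (G : wpGroupoid P) (a : G) (p : P)
  (h : gle (idn G p) (idn G (dom a))) : P := ran (restl h).

Lemma proj_gle (P : projAlg) (G : wpGroupoid P) (p q : P) :
  gle (idn G (p θ q)) (idn G q).
Proof. by apply/wpg_le; exact: proj_ple. Qed.

(* $p\Theta_a$ *)
Definition Theta (P : projAlg) (G : wpGroupoid P) (a : G) (p : P) : P :=
  vtheta (proj_gle G p (dom a)).

Record projGroupoid (P : projAlg) := ProjGroupoid {
  pg_wpg :> wpGroupoid P;
  pg_proj : forall (p : P) (a : pg_wpg) (x : P),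
    x θ (Theta a p) = Theta a (Theta (ginv a) x θ p)
}.

Definition linked (P : projAlg) (G : wpGroupoid P) (b : G) (e f : P) : Prop :=
  f = Theta b e θ f /\ e = Theta (ginv b) f θ e.

Record evalMap (P : projAlg) (G : wpGroupoid P) := EvalMap {
  ev :> chain P -> G;
  ev_functor : gfunctor_spec (fun p : P => p) ev;
  ev_restl : forall (c : chain P) (p : P)
    (h : gle (idn (chain P) p) (idn (chain P) (dom c)))
    (h' : gle (idn G p) (idn G (dom (ev c)))),
    ev (restl h) = restl h'
}.

Definition ch (P : projAlg) (s : ppath P) : chain P := pcls (chain_cong P) s.
Definition rch (P : projAlg) (s : ppath P) : rchain P := pcls (rchain_cong P) s.

Lemma restl_eq (P : Type) (G : ordGroupoid P) (p q : P) (a : G)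
  (hp : gle (idn G p) (idn G (dom a))) (hq : gle (idn G q) (idn G (dom a))) :
  p = q -> restl hp = restl hq.
Proof.
by move=> pq; apply: restl_uniq; rewrite ?pq; case: (restlP hq).
Qed.

Lemma Theta_ple (P : projAlg) (G : wpGroupoid P) (b : G) (p : P) :
  ple (Theta b p) (ran b).
Proof.
by apply/wpg_le/gle_ran; case: (restlP (proj_gle G p (dom b))).
Qed.

Lemma Theta_ginv_gle (P : projAlg) (G : wpGroupoid P) (b : G) (p : P) :
  gle (idn G (Theta (ginv b) p)) (idn G (dom b)).
Proof. by apply/wpg_le; rewrite -ran_inv; exact: Theta_ple. Qed.

Lemma Theta_restl (P : projAlg) (G : wpGroupoid P) (b : G) (p : P) :
  ran (restl (proj_gle G p (dom b))) = Theta b p.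
Proof. by []. Qed.

Lemma ran_restl_Theta_ginv (P : projAlg) (G : wpGroupoid P) (b : G) (p : P) :
  ran (restl (Theta_ginv_gle b p)) = p θ ran b.
Proof.
have [ub ud] := restlP (proj_gle G p (dom (ginv b))).
rewrite (@restl_uniq _ _ _ _ (ginv (restl (proj_gle G p (dom (ginv b)))))).
- by rewrite ran_inv ud dom_inv.
- by rewrite -[X in gle _ X]invK; exact: gle_inv.
- by rewrite dom_inv.
Qed.

Lemma ple_mono (P : projAlg) (q d e : P) : ple q d -> ple (q θ e) (d θ e).
Proof. by move=> qd; rewrite /ple -proj_conj projK [in RHS]qd proj_rep -qd. Qed.

Lemma pF_edge (P : projAlg) (q d e : P) :
  ple q d -> e = q θ e -> pF e (e θ d).
Proof.
move=> qd eE; split; rewrite /pleF.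
  rewrite proj_back; apply: ple_anti; last exact: proj_ple.
  by rewrite {1}eE; exact: ple_mono.
rewrite -proj_conj -[X in X θ d θ e θ d](proj_id e) proj_rep.
by rewrite proj_id.
Qed.

Lemma linked_sym (P : projAlg) (G : wpGroupoid P) (b : G) (e f : P) :
  linked b e f -> linked (ginv b) f e.
Proof. by case=> ? ?; split; rewrite ?invK. Qed.

Lemma linked_pF_e1 (P : projAlg) (G : wpGroupoid P) (b : G) (e f : P) :
  linked b e f -> pF e (e θ dom b).
Proof.
move=> [_ eE]; apply: pF_edge eE; rewrite -ran_inv; exact: Theta_ple.
Qed.

Lemma linked_pF_f2 (P : projAlg) (G : wpGroupoid P) (b : G) (e f : P) :
  linked b e f -> pF (f θ ran b) f.
Proof. by move=> /linked_sym/linked_pF_e1; rewrite dom_inv => /pF_sym. Qed.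

Lemma linked_pF_f1 (P : projAlg) (G : projGroupoid P) (b : G) (e f : P) :
  linked b e f -> pF (Theta b e) f.
Proof.
by move=> [fE eE]; split; rewrite /pleF // pg_proj -eE.
Qed.

Lemma linked_pF_e2 (P : projAlg) (G : projGroupoid P) (b : G) (e f : P) :
  linked b e f -> pF e (Theta (ginv b) f).
Proof. by move=> /linked_sym/linked_pF_f1/pF_sym. Qed.

Lemma dom_ev (P : projAlg) (G : wpGroupoid P) (eps : evalMap G) (s : ppath P) :
  dom (eps (ch s)) = pdom s.
Proof. by rewrite (gf_dom (ev_functor eps)) /= qdom_pcls. Qed.

Lemma ran_ev (P : projAlg) (G : wpGroupoid P) (eps : evalMap G) (s : ppath P) :
  ran (eps (ch s)) = pran s.
Proof. by rewrite (gf_ran (ev_functor eps)) /= qran_pcls. Qed.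

Lemma lambda_h1 (P : projAlg) (G : projGroupoid P) (eps : evalMap G)
    (b : G) (e f : P) (L : linked b e f) :
  ran (eps (ch (pedge (linked_pF_e1 L)))) =
  dom (restl (proj_gle G e (dom b))).
Proof. by rewrite ran_ev (proj2 (restlP _)). Qed.

Lemma lambda_h2 (P : projAlg) (G : projGroupoid P) (eps : evalMap G)
    (b : G) (e f : P) (L : linked b e f) :
  ran (gcomp (lambda_h1 eps L)) = dom (eps (ch (pedge (linked_pF_f1 L)))).
Proof. by rewrite ran_comp dom_ev Theta_restl. Qed.

Lemma rho_h1 (P : projAlg) (G : projGroupoid P) (eps : evalMap G)
    (b : G) (e f : P) (L : linked b e f) :
  ran (eps (ch (pedge (linked_pF_e2 L)))) = dom (restl (Theta_ginv_gle b f)).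
Proof. by rewrite ran_ev (proj2 (restlP _)). Qed.

Lemma rho_h2 (P : projAlg) (G : projGroupoid P) (eps : evalMap G)
    (b : G) (e f : P) (L : linked b e f) :
  ran (gcomp (rho_h1 eps L)) = dom (eps (ch (pedge (linked_pF_f2 L)))).
Proof. by rewrite ran_comp dom_ev ran_restl_Theta_ginv. Qed.

(* $\lambda(e,b,f)=\varepsilon[e,e_1]\circ{}_{e_1}{\downharpoonleft}b
   \circ\varepsilon[f_1,f]$ with $e_1=e\theta_{\mathbf d(b)}$ and
   $f_1=e\Theta_b$. *)
Definition lambda (P : projAlg) (G : projGroupoid P) (eps : evalMap G)
    (b : G) (e f : P) (L : linked b e f) : G :=
  @gcomp P G
    (@gcomp P G (eps (ch (pedge (linked_pF_e1 L))))
                (restl (proj_gle G e (dom b)))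
                (lambda_h1 eps L))
    (eps (ch (pedge (linked_pF_f1 L))))
    (lambda_h2 eps L).

(* $\rho(e,b,f)=\varepsilon[e,e_2]\circ{}_{e_2}{\downharpoonleft}b
   \circ\varepsilon[f_2,f]$ with $e_2=f\Theta_{b^{-1}}$ and
   $f_2=f\theta_{\mathbf r(b)}$. *)
Definition rho (P : projAlg) (G : projGroupoid P) (eps : evalMap G)
    (b : G) (e f : P) (L : linked b e f) : G :=
  @gcomp P G
    (@gcomp P G (eps (ch (pedge (linked_pF_e2 L))))
                (restl (Theta_ginv_gle b f))
                (rho_h1 eps L))
    (eps (ch (pedge (linked_pF_f2 L))))
    (rho_h2 eps L).

Record cpg := Cpg {
  cpg_P : projAlg;
  cpg_G :> projGroupoid cpg_P;
  cpg_ev : evalMap cpg_G;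
  cpg_ax : forall (b : cpg_G) (e f : cpg_P) (L : linked b e f),
    lambda cpg_ev L = rho cpg_ev L
}.

Record cpgMor (X Y : cpg) := CpgMor {
  cm_ob : paMor (cpg_P X) (cpg_P Y);
  cm_mor :> X -> Y;
  cm_functor : gfunctor_spec cm_ob cm_mor;
  cm_mono : forall a b : X, gle a b -> gle (cm_mor a) (cm_mor b);
  cm_ev : forall s : ppath (cpg_P X),
    cm_mor (cpg_ev X (ch s)) = cpg_ev Y (ch (ppath_map cm_ob s))
}.

Lemma cpgMor_eq (X Y : cpg) (f g : cpgMor X Y) :
  cm_ob f = cm_ob g -> cm_mor f = cm_mor g -> f = g.
Proof.
case: f g => [fo fm f1 f2 f3] [go gm g1 g2 g3] /= E1 E2; subst go gm.
by congr CpgMor; exact: Prop_irrelevance.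
Qed.

Program Definition cpgMor_id (X : cpg) : cpgMor X X :=
  @CpgMor X X (paMor_id _) (fun a => a) _ _ _.
Next Obligation.
move=> X; split=> // a b h h'; exact: gcomp_eq.
Qed.
Next Obligation. by []. Qed.
Next Obligation.
move=> X s /=; congr (cpg_ev X (ch _)); apply: ppath_eq.
by rewrite /pseq /= map_id.
Qed.

Program Definition cpgMor_comp (X Y Z : cpg) (f : cpgMor X Y) (g : cpgMor Y Z) :
  cpgMor X Z :=
  @CpgMor X Z (paMor_comp (cm_ob f) (cm_ob g)) (fun a => g (f a)) _ _ _.
Next Obligation.
move=> X Y Z f g; have [F1 F2 F3 F4] := cm_functor f.
have [G1 G2 G3 G4] := cm_functor g.
split=> [a|a|p|a b h h'] /=.
- by rewrite G1 F1.
- by rewrite G2 F2.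
- by rewrite F3 G3.
have k : ran (f a) = dom (f b) by rewrite F2 F1 h.
by rewrite (F4 _ _ h k) (G4 _ _ k h').
Qed.
Next Obligation. by move=> X Y Z f g a b ab; do 2!apply: cm_mono. Qed.
Next Obligation.
move=> X Y Z f g s /=; rewrite !cm_ev; congr (cpg_ev Z (ch _)).
by apply: ppath_eq; rewrite /pseq /= -map_comp.
Qed.

Program Definition CPG : category :=
  @Category cpg cpgMor cpgMor_id cpgMor_comp _ _ _.
Next Obligation. by move=> *; apply: cpgMor_eq => //; exact: paMor_eq. Qed.
Next Obligation. by move=> *; apply: cpgMor_eq => //; exact: paMor_eq. Qed.
Next Obligation. by move=> *; apply: cpgMor_eq => //; exact: paMor_eq. Qed.

Program Definition forgetful : functor CPG PA :=
  @Functor CPG PA cpg_P cm_ob _ _.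
Next Obligation. by []. Qed.
Next Obligation. by []. Qed.

Definition rchain_wpg (P : projAlg) : wpGroupoid P :=
  @WPGroupoid P (rchain P) (@qle_idn P (rchain_cong P)).

Lemma Theta_rch (P : projAlg) (s : ppath P) (x : P) :
  Theta (G := rchain_wpg P) (rch s) x = foldl (@proj P) x (pseq s).
Proof.
rewrite /Theta /vtheta /= (restl_pcls (proj_gle (rchain_wpg P) x _)).
by rewrite qran_pcls /= qdom_pcls prestl_proj pran_prestl.
Qed.

Lemma foldl_proj (P : projAlg) (l : seq P) (p x : P) :
  x θ (foldl (@proj P) p l) = foldl (@proj P) (foldl (@proj P) x (rev l) θ p) l.
Proof.
elim: l p => [|y l IH] p //=.
by rewrite IH rev_cons foldl_rcons proj_conj.
Qed.

Program Definition rchain_pg (P : projAlg) : projGroupoid P :=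
  @ProjGroupoid P (rchain_wpg P) _.
Next Obligation.
move=> P p; apply: qmorW => s x.
have -> : ginv (pcls (rchain_cong P) s : rchain_wpg P) = rch (ppath_rev s).
  exact: qinv_pcls.
by rewrite !Theta_rch pseq_prev; exact: foldl_proj.
Qed.

Definition nu (P : projAlg) (c : chain P) : rchain P := rch (prep c).

Lemma chain_rchain (P : projAlg) (s t : ppath P) :
  chain_cong P s t -> rchain_cong P s t.
Proof.
elim=> {s t} /=.
- by move=> s t st; apply/cg_gen/rchain_gen_chain.
- exact: cg_refl.
- by move=> s t _; exact: cg_sym.
- by move=> s t u _ st _; exact: cg_trans.
- by move=> *; exact: cg_comp.
Qed.

Lemma nu_ch (P : projAlg) (s : ppath P) : nu (ch s) = rch s.
Proof. by apply/pclsP/chain_rchain/pcls_prep. Qed.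

Program Definition nu_ev (P : projAlg) : evalMap (rchain_pg P) :=
  @EvalMap P (rchain_pg P) (@nu P) _ _.
Next Obligation.
move=> P; split.
- by apply: qmorW => s; rewrite /= nu_ch !qdom_pcls.
- by apply: qmorW => s; rewrite /= nu_ch !qran_pcls.
- by move=> p; rewrite /= nu_ch.
apply: qmorW => s; apply: qmorW => t h h'.
have k : pran s = pdom t by move: (h); rewrite /= qran_pcls qdom_pcls.
rewrite /= (qcompE h k) //.
by rewrite (nu_ch (pcomp k)); symmetry; apply: qcompE; exact: nu_ch.
Qed.
Next Obligation.
move=> P; apply: qmorW => s q h h'.
rewrite (restl_pcls h) (nu_ch (prestl q s)); symmetry.
have qs : ple q (pdom s) by move: (h) => /qle_idn; rewrite /= qdom_pcls.
apply: restl_uniq; rewrite /= ?nu_ch; first exact: qle_prestl.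
by rewrite qdom_pcls pdom_prestl.
Qed.

Lemma plinked_pF (P : projAlg) (p e f : P) :
  plinked p e f -> pF e (e θ p) /\ pF (e θ p) f.
Proof.
move=> [fE eE]; split.
  by apply: pF_edge eE; exact: proj_ple.
by split; rewrite /pleF // -proj_conj -eE.
Qed.

Lemma foldl_rev_ple (P : projAlg) (p f : P) (l : seq P) :
  ple (foldl (@proj P) f (rev (p :: l))) p.
Proof. by rewrite rev_cons foldl_rcons; exact: proj_ple. Qed.

Lemma lambda_rho_cong (P : projAlg) (p : P) (l : seq P) (e f : P)
    (u v : ppath P) :
  path (@pFb P) p l ->
  f = foldl (@proj P) e (p :: l) θ f ->
  e = foldl (@proj P) f (rev (p :: l)) θ e ->
  pseq u = e :: rcons (scanl (@proj P) e (p :: l)) f ->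
  pseq v = e :: rcons (scanl (@proj P) (foldl (@proj P) f (rev (p :: l)))
                         (p :: l)) f ->
  rchain_cong P u v.
Proof.
elim: l p e u v => [|p' l IH] p e u v.
  move=> _ /= fE eE uE vE; apply/cg_gen/(@rchain_gen_linked _ _ _ p e f) => //.
  by rewrite vE projK.
rewrite [path _ _ _]/= => /andP[/asboolP pp' lP] fE.
rewrite rev_cons foldl_rcons.
set g := foldl _ f (rev (p' :: l)) => eE uE vE.
have gp' : ple g p' by exact: foldl_rev_ple.
have gE : g = e θ p θ g.
  rewrite /g foldl_proj revK -[X in foldl _ (X θ f) _]/(foldl (@proj P) e (p :: p' :: l)).
  by rewrite -fE.
have L : plinked p e g by [].
have [F1 F2] := plinked_pF L.
have {}vE : pseq v = e :: g θ p :: rcons (scanl (@proj P) g (p' :: l)) f.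
  by rewrite vE /= projK pF_projK ?[in g θ p']/=; [rewrite -gp'| exact: pF_sym|].
have vP : path (@pFb P) g (rcons (scanl (@proj P) g l) f).
  by have /= := pseq_path vE; rewrite -gp' => /and3P[].
have uP : path (@pFb P) (e θ p) (rcons (scanl (@proj P) (e θ p) (p' :: l)) f).
  by have /= := pseq_path uE => /andP[].
have wP : path (@pFb P) (e θ p) (g :: rcons (scanl (@proj P) g l) f).
  by rewrite /= vP andbT; apply/asboolP.
have {IH} IH : rchain_cong P (PPath uP) (PPath wP).
  apply: (IH p' (e θ p)) => //.
    by rewrite -/g -proj_conj -eE.
  by rewrite /pseq /= -gp'.
pose ue := pedge F1.
have k1 : pran ue = pdom (PPath uP) by [].
have k2 : pran ue = pdom (PPath wP) by [].
have -> : u = pcomp k1 by apply: ppath_eq; rewrite uE.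
apply: (@pcg_trans _ (rchain_cong P) _ (pcomp k2)).
  by apply: pcg_comp => //; exact: pcg_refl.
have k3 : pran ue = pdom (pedge F2) by [].
have [F3 F4] := plinked_pF (plinked_sym L).
have k4 : pran (pedge (pF_sym F4)) = pdom (pedge (pF_sym F3)) by [].
have k5 : pran (pcomp k3) = pdom (PPath vP) by [].
have k6 : pran (pcomp k4) = pdom (PPath vP) by [].
have -> : pcomp k2 = pcomp k5 by exact: ppath_eq.
have -> : v = pcomp k6 by apply: ppath_eq; rewrite vE /pseq /= -gp'.
apply: pcg_comp; last exact: pcg_refl.
by apply/cg_gen/(@rchain_gen_linked _ _ _ p e g).
Qed.

Program Definition rchain_cpg (P : projAlg) : cpg :=
  @Cpg P (rchain_pg P) (nu_ev P) _.
Next Obligation.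
move=> P; apply: qmorW => s e f L.
have iE : ginv (pcls (rchain_cong P) s : rchain_pg P) = rch (ppath_rev s).
  exact: qinv_pcls.
have := L; rewrite /linked iE !Theta_rch pseq_prev => -[fE eE].
have e2E : Theta (ginv (pcls (rchain_cong P) s : rchain_pg P)) f =
  foldl (@proj P) f (rev (pseq s)) by rewrite iE Theta_rch pseq_prev.
have e2s : ple (Theta (ginv (pcls (rchain_cong P) s : rchain_pg P)) f) (pdom s).
  by rewrite e2E; exact: foldl_rev_ple.
rewrite /lambda /rho.
move: (lambda_h1 _ _) (lambda_h2 _ _) => h1 h2.
move: (rho_h1 _ _) (rho_h2 _ _) => h3 h4.
have k1 : pran (pedge (linked_pF_e1 L)) = pdom (prestl (e θ dom (pcls (rchain_cong P) s : rchain_pg P)) s).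
  by rewrite pdom_prestl //= qdom_pcls; exact: proj_ple.
have k2 : pran (pcomp k1) = pdom (pedge (linked_pF_f1 L)).
  rewrite pran_pcomp pran_prestl /= (Theta_rch s) qdom_pcls /pdom.
  by rewrite [in LHS]/= projK.
have k3 : pran (pedge (linked_pF_e2 L)) = pdom (prestl (Theta (ginv (pcls (rchain_cong P) s : rchain_pg P)) f) s).
  by rewrite pdom_prestl.
have k4 : pran (pcomp k3) = pdom (pedge (linked_pF_f2 L)).
  rewrite pran_pcomp; have := ran_restl_Theta_ginv (pcls (rchain_cong P) s : rchain_pg P) f.
  by rewrite (restl_pcls (Theta_ginv_gle (pcls (rchain_cong P) s : rchain_pg P) f)) /= qran_pcls.
have E1 := qcompE h1 k1 (nu_ch _) (restl_pcls _).
have E3 := qcompE h3 k3 (nu_ch _) (restl_pcls _).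
rewrite [LHS](qcompE h2 k2 E1 (nu_ch _)) [RHS](qcompE h4 k4 E3 (nu_ch _)).
apply/pclsP; apply: (lambda_rho_cong (ppathP s) fE eE).
  by rewrite /pseq /= qdom_pcls projK cats1.
by rewrite -e2E /pseq /= cats1; congr [:: _, _ & _].
Qed.

Lemma rchain_cong_map (P Q : projAlg) (f : paMor P Q) (s t : ppath P) :
  rchain_cong P s t -> rchain_cong Q (ppath_map f s) (ppath_map f t).
Proof.
have mapE (r : ppath P) : pseq (ppath_map f r) = map f (pseq r) by [].
elim=> {s t} /=.
- move=> s t [[p|p q]|p e g [L1 L2]] sE tE; apply: cg_gen.
  + by apply/rchain_gen_chain/(@chain_gen_dup _ _ _ (f p)); rewrite mapE ?sE ?tE.
  + by apply/rchain_gen_chain/(@chain_gen_back _ _ _ (f p) (f q)); rewrite mapE ?sE ?tE.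
  + apply: (@rchain_gen_linked _ _ _ (f p) (f e) (f g)).
    * by split; rewrite -!pamM -?L1 -?L2.
    * by rewrite mapE sE /= pamM.
    * by rewrite mapE tE /= pamM.
- by move=> s; exact: cg_refl.
- by move=> s t _; exact: cg_sym.
- by move=> s t u _ st _; exact: cg_trans.
move=> s s' t t' h h' _ ss _ tt.
have mapc (a b : ppath P) (k : pran a = pdom b)
    (k' : pran (ppath_map f a) = pdom (ppath_map f b)) :
    ppath_map f (pcomp k) = pcomp k'.
  by apply: ppath_eq; rewrite /pseq /= map_cat.
have k (a b : ppath P) : pran a = pdom b ->
    pran (ppath_map f a) = pdom (ppath_map f b).
  by rewrite /pran /pdom /= last_map => ->.
by rewrite (mapc _ _ _ (k _ _ h)) (mapc _ _ _ (k _ _ h')); exact: cg_comp.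
Qed.

Definition rchain_map (P Q : projAlg) (f : paMor P Q) (c : rchain P) : rchain Q :=
  rch (ppath_map f (prep c)).

Lemma rchain_map_rch (P Q : projAlg) (f : paMor P Q) (s : ppath P) :
  rchain_map f (rch s) = rch (ppath_map f s).
Proof. by apply/pclsP/rchain_cong_map/pcls_prep. Qed.

Lemma pran_map (P Q : projAlg) (f : paMor P Q) (s : ppath P) :
  pran (ppath_map f s) = f (pran s).
Proof. by rewrite /pran /= last_map. Qed.

Lemma ppath_map_prestl (P Q : projAlg) (f : paMor P Q) (q : P) (s : ppath P) :
  ppath_map f (prestl q s) = prestl (f q) (ppath_map f s).
Proof.
apply: ppath_eq; rewrite /pseq /= -pamM; congr cons.
by elim: (ptail s) (q θ _) => //= y t IH x; rewrite -pamM IH.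
Qed.

Program Definition rchain_mor (P Q : projAlg) (f : paMor P Q) :
    cpgMor (rchain_cpg P) (rchain_cpg Q) :=
  @CpgMor (rchain_cpg P) (rchain_cpg Q) f (rchain_map f) _ _ _.
Next Obligation.
move=> P Q f; split.
- by apply: qmorW => s; rewrite /= rchain_map_rch !qdom_pcls.
- by apply: qmorW => s; rewrite /= rchain_map_rch !qran_pcls pran_map.
- move=> p; rewrite /= (rchain_map_rch f (pid p)); congr pcls.
  exact: ppath_eq.
apply: qmorW => s; apply: qmorW => t h h'.
have k : pran s = pdom t by move: (h); rewrite /= qran_pcls qdom_pcls.
have k' : pran (ppath_map f s) = pdom (ppath_map f t) by rewrite pran_map k.
rewrite /= (qcompE h k) // (qcompE h' k') ?rchain_map_rch //.
by congr pcls; apply: ppath_eq; rewrite /pseq /= map_cat.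
Qed.
Next Obligation.
move=> P Q f a b [s [q [-> qs ->]]]; rewrite /= !rchain_map_rch.
rewrite ppath_map_prestl; apply: qle_prestl.
by rewrite /ple -pamM -qs.
Qed.
Next Obligation.
by move=> P Q f s; rewrite /= !nu_ch rchain_map_rch.
Qed.

Program Definition rchain_functor : functor PA CPG :=
  @Functor PA CPG rchain_cpg rchain_mor _ _.
Next Obligation.
move=> P; apply: cpgMor_eq => //=; apply/funext; apply: qmorW => s.
rewrite rchain_map_rch; congr pcls.
by apply: ppath_eq; rewrite /pseq /= map_id.
Qed.
Next Obligation.
move=> P Q R f g; apply: cpgMor_eq => //=; apply/funext; apply: qmorW => s.
rewrite rchain_map_rch (rchain_map_rch f) (rchain_map_rch g); congr pcls.
by apply: ppath_eq; rewrite /pseq /= -map_comp.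
Qed.

(* Main.v *)
From mathcomp Require Import all_boot.
From mathcomp Require Import boolp.
Require Import Defs.

(** A morphism of chained projection groupoids out of $\overline{\mathscr C}(P)$
   is determined by its object part, because every element of
   $\overline{\mathscr C}(P)$ is a value of the evaluation map $\nu$ and
   morphisms commute with evaluation ([cpgMor_rchain_eq]). So taking object
   parts is injective, and the adjunction amounts to the existence of an
   extension of each projection algebra morphism $\phi : P\to P'$ to a morphism
   $\overline{\mathscr C}(P)\to(P',\mathcal G,\varepsilon)$. The only possible one is
   $[\![p_1,\dots,p_k]\!]\mapsto\varepsilon[p_1\phi,\dots,p_k\phi]$
   ([rchain_lift]).

   That this is well defined is where the axiom $\lambda=\rho$ enters. The
   generators (1) and (2) already hold in $\mathscr C(P')$. For (3), if $b$ is the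
   identity at $p$, then $\Theta_b=\theta_p$, so $b$-linked means $p$-linked,
   and the restrictions of $b$ are identities; therefore
   $\lambda(e,b,f)=\varepsilon[e,e\theta_p,f]$ and
   $\rho(e,b,f)=\varepsilon[e,f\theta_p,f]$ ([ev_linked]). Hence $\varepsilon$
   identifies paths congruent under $\equiv$ ([ev_rchain_cong]).

   Coreflectivity uses the same functor. It is an embedding because both $P$
   and $\phi$ are recovered as object parts, and it is full because a
   morphism between reduced chain groupoids agrees with the image of its own
   object part. *)

Set Implicit Arguments.
Unset Strict Implicit.
Unset Printing Implicit Defensive.

Lemma ginv_idn (P : Type) (G : ordGroupoid P) (p : P) :
  ginv (idn G p) = idn G p.
Proof.
have h : ran (idn G p) = dom (ginv (idn G p)) by rewrite dom_inv.
have k : ran (idn G (dom (ginv (idn G p)))) = dom (ginv (idn G p)).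
  by rewrite ran_idn.
have := gcomp_inv_r h; rewrite dom_idn => E.
rewrite -[RHS]E -[LHS](gcomp1l k).
by apply: gcomp_eq; rewrite // dom_inv ran_idn.
Qed.

Lemma restl_idn (P : Type) (G : ordGroupoid P) (p q : P)
  (h : gle (idn G q) (idn G (dom (idn G p)))) : restl h = idn G q.
Proof. by apply: restl_uniq; rewrite ?dom_idn //; move: h; rewrite dom_idn. Qed.

Lemma Theta_idn (P : projAlg) (G : wpGroupoid P) (p x : P) :
  Theta (idn G p) x = x θ p.
Proof. by rewrite /Theta /vtheta restl_idn ran_idn dom_idn. Qed.

Lemma plinked_linked_idn (P : projAlg) (G : wpGroupoid P) (p e f : P) :
  plinked p e f -> linked (idn G p) e f.
Proof. by case=> fE eE; split; rewrite ?ginv_idn Theta_idn. Qed.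

Lemma ev_pcomp (P : projAlg) (G : wpGroupoid P) (eps : evalMap G)
    (s t : ppath P) (h : pran s = pdom t)
    (h' : ran (eps (ch s)) = dom (eps (ch t))) :
  eps (ch (pcomp h)) = gcomp h'.
Proof.
have k : ran (ch s) = dom (ch t) by rewrite /= qran_pcls qdom_pcls.
by rewrite -(gf_comp (ev_functor eps) k) /= (qcompE k h).
Qed.

(** A path $(e,x,f)$ is evaluated as $\varepsilon[e,x]\circ x\circ
   \varepsilon[x,f]$, the shape taken by $\lambda$ and $\rho$ when their
   middle factor is an identity. The end points of the two edges are only
   propositionally equal to $x$ there, hence the separate $x_1$, $x_2$. *)
Lemma ev_two_edges (P : projAlg) (G : projGroupoid P) (eps : evalMap G)
    (e x x1 x2 f : P) (ex : pF e x1) (xf : pF x2 f) (c : G)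
    (h1 : ran (eps (ch (pedge ex))) = dom c)
    (h2 : ran (gcomp h1) = dom (eps (ch (pedge xf)))) (s : ppath P) :
  x1 = x -> x2 = x -> c = idn G x -> pseq s = [:: e; x; f] ->
  gcomp h2 = eps (ch s).
Proof.
move=> E1 E2 cE sE; subst x1 x2 c.
have k : pran (pedge ex) = pdom (pedge xf) by [].
have -> : s = pcomp k by exact: ppath_eq.
have k' : ran (eps (ch (pedge ex))) = dom (eps (ch (pedge xf))).
  by rewrite ran_ev dom_ev.
rewrite (ev_pcomp k k').
apply: gcomp_eq => //.
have k1 : ran (eps (ch (pedge ex))) = dom (idn G (ran (eps (ch (pedge ex))))).
  by rewrite dom_idn.
by rewrite -[RHS](gcomp1r k1); apply: gcomp_eq => //; rewrite ran_ev.
Qed.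

(** The equation $\lambda(e,b,f)=\rho(e,b,f)$ for $b$ the identity at $p$. *)
Lemma ev_linked (X : cpg) (p e f : cpg_P X) (s t : ppath (cpg_P X)) :
  plinked p e f -> pseq s = [:: e; e θ p; f] -> pseq t = [:: e; f θ p; f] ->
  cpg_ev X (ch s) = cpg_ev X (ch t).
Proof.
move=> L sE tE; have K := plinked_linked_idn X L.
have := cpg_ax K; rewrite /lambda /rho.
have -> := ev_two_edges (x := e θ p) (lambda_h2 (cpg_ev X) K) _ _ _ sE.
- have -> // := ev_two_edges (x := f θ p) (rho_h2 (cpg_ev X) K) _ _ _ tE.
  + by rewrite ginv_idn Theta_idn.
  + by rewrite ran_idn.
  + by rewrite restl_idn ginv_idn Theta_idn.
- by rewrite dom_idn.
- by rewrite Theta_idn.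
- by rewrite restl_idn dom_idn.
Qed.

(** The evaluation map factors through $\nu$: its kernel contains the
   generators of $\equiv$ and, $\varepsilon$ being a functor, is a
   congruence. *)
Lemma ev_rchain_cong (X : cpg) (s t : ppath (cpg_P X)) :
  rchain_cong (cpg_P X) s t -> cpg_ev X (ch s) = cpg_ev X (ch t).
Proof.
elim=> {s t} //=.
- move=> s t [st|p e f L sE tE]; last exact: ev_linked L sE tE.
  by congr (cpg_ev X _); apply/pclsP/cg_gen.
- by move=> s t u _ -> _ ->.
move=> s s' t t' h h' _ Es _ Et.
have k : ran (cpg_ev X (ch s)) = dom (cpg_ev X (ch t)).
  by rewrite ran_ev dom_ev.
have k' : ran (cpg_ev X (ch s')) = dom (cpg_ev X (ch t')).
  by rewrite ran_ev dom_ev.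
by rewrite (ev_pcomp h k) (ev_pcomp h' k'); exact: gcomp_eq.
Qed.

Lemma ev_prestl_gle (P : projAlg) (G : wpGroupoid P) (eps : evalMap G)
    (q : P) (s : ppath P) :
  ple q (pdom s) -> gle (eps (ch (prestl q s))) (eps (ch s)).
Proof.
move=> qs.
have h : gle (idn (chain P) q) (idn (chain P) (dom (ch s))).
  by apply/qle_idn; rewrite /= qdom_pcls.
have h' : gle (idn G q) (idn G (dom (eps (ch s)))).
  by rewrite dom_ev; apply/wpg_le.
have := ev_restl h h'; rewrite (restl_pcls h) => ->.
by case: (restlP h').
Qed.

Definition rchain_lift_mor (P : projAlg) (X : cpg) (f : paMor P (cpg_P X))
  (c : rchain P) : X := cpg_ev X (ch (ppath_map f (prep c))).

Lemma rchain_lift_rch (P : projAlg) (X : cpg) (f : paMor P (cpg_P X))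
    (s : ppath P) :
  rchain_lift_mor f (rch s) = cpg_ev X (ch (ppath_map f s)).
Proof. by apply/ev_rchain_cong/rchain_cong_map/pcls_prep. Qed.

Lemma rchain_lift_functor (P : projAlg) (X : cpg) (f : paMor P (cpg_P X)) :
  gfunctor_spec (G := rchain P) (H := X) f (rchain_lift_mor f).
Proof.
split.
- by apply: qmorW => s; rewrite rchain_lift_rch dom_ev /= qdom_pcls.
- by apply: qmorW => s; rewrite rchain_lift_rch ran_ev /= qran_pcls pran_map.
- move=> p; rewrite (rchain_lift_rch f (pid p)).
  rewrite -(gf_idn (ev_functor (cpg_ev X))); congr (cpg_ev X (pcls _ _)).
  exact: ppath_eq.
apply: qmorW => s; apply: qmorW => t h h'.
have k : pran s = pdom t by move: (h); rewrite /= qran_pcls qdom_pcls.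
have k' : pran (ppath_map f s) = pdom (ppath_map f t) by rewrite pran_map k.
rewrite /= (qcompE h k) // (rchain_lift_rch f (pcomp k)).
have -> : ppath_map f (pcomp k) = pcomp k'.
  by apply: ppath_eq; rewrite /pseq /= map_cat.
have e : ran (cpg_ev X (ch (ppath_map f s))) =
    dom (cpg_ev X (ch (ppath_map f t))) by rewrite ran_ev dom_ev.
rewrite (ev_pcomp k' e).
by apply: gcomp_eq; rewrite rchain_lift_rch.
Qed.

Lemma rchain_lift_mono (P : projAlg) (X : cpg) (f : paMor P (cpg_P X))
    (a b : rchain P) :
  gle a b -> gle (rchain_lift_mor f a) (rchain_lift_mor f b).
Proof.
move=> [s [q [-> qs ->]]]; rewrite !rchain_lift_rch ppath_map_prestl.
by apply: ev_prestl_gle; rewrite /ple -pamM -qs.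
Qed.

Lemma rchain_lift_ev (P : projAlg) (X : cpg) (f : paMor P (cpg_P X))
    (s : ppath P) :
  rchain_lift_mor f (nu_ev P (ch s)) = cpg_ev X (ch (ppath_map f s)).
Proof. by rewrite /= nu_ch rchain_lift_rch. Qed.

Definition rchain_lift (P : projAlg) (X : cpg) (f : paMor P (cpg_P X)) :
    cpgMor (rchain_cpg P) X :=
  @CpgMor (rchain_cpg P) X f (rchain_lift_mor f) (rchain_lift_functor f)
    (@rchain_lift_mono P X f) (@rchain_lift_ev P X f).

(** Every element of $\overline{\mathscr C}(P)$ is evaluated from a path, and
   morphisms preserve evaluation, so the object part decides everything. *)
Lemma cpgMor_rchain_eq (P : projAlg) (X : cpg)
    (u v : cpgMor (rchain_cpg P) X) : cm_ob u = cm_ob v -> u = v.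
Proof.
move=> uv; apply: cpgMor_eq => //; apply/funext; apply: qmorW => s.
have := cm_ev v s; rewrite -uv -cm_ev /= nu_ch => E.
exact: esym E.
Qed.

Lemma rchain_functor_left_adjoint : left_adjoint rchain_functor forgetful.
Proof.
exists (fun (A : PA) (X : CPG) (u : cpgMor (rchain_cpg A) X) => cm_ob u).
split=> // A X; exists (@rchain_lift A X) => // u.
exact: cpgMor_rchain_eq.
Qed.

Lemma rchain_functor_full_embedding : full_embedding rchain_functor.
Proof.
split.
- by move=> P Q /(congr1 cpg_P).
- by move=> P Q f g /(congr1 (@cm_ob _ _)).
by move=> P Q g; exists (cm_ob g); exact: cpgMor_rchain_eq.
Qed.

Theorem theorem5p2 :
  left_adjoint rchain_functor forgetful /\ coreflective PA CPG.
Proof.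
split; first exact: rchain_functor_left_adjoint.
exists rchain_functor; split; first exact: rchain_functor_full_embedding.
by exists forgetful; exact: rchain_functor_left_adjoint.
Qed.
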